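(* Let $\mathbb{K}$ be an algebraically closed field of characteristic $\neq 2$, let $V$ be a finite-dimensional vector space over $\mathbb{K}$, and let $A$ and $B$ be skew-symmetric bilinear forms on $V$. Then there exists a basis of $V$ in which the matrices of both forms are block-diagonal with blocks of the same sizes, $$A=\operatorname{diag}(A_1,A_2,\dots,A_k),\qquad B=\operatorname{diag}(B_1,B_2,\dots,B_k),$$ where each pair of corresponding blocks $(A_i,B_i)$ is one of the following. 1. (Jordan block with eigenvalue $\lambda\in\mathbb{K}$) For some $n\ge 1$ and some $\lambda\in\mathbb{K}$, the $2n\times 2n$ matrices $$A_i=\begin{pmatrix}0 & J_n(\lambda)\\ -J_n(\lambda)^{T} & 0\end{pmatrix},\qquad B_i=\begin{pmatrix}0 & E_n\\ -E_n & 0\end{pmatrix}.$$ 2. (Jordan block with eigenvalue $\infty$) For some $n\ge 1$, the $2n\times 2n$ matrices $$A_i=\begin{pmatrix}0 & E_n\\ -E_n & 0\end{pmatrix},\qquad B_i=\begin{pmatrix}0 & J_n(0)\\ -J_n(0)^{T} & 0\end{pmatrix}.$$ 3. (Kronecker block) For some $n\ge 0$, the $(2n+1)\times(2n+1)$ matrices $$A_i=\begin{pmatrix}0 & S_n\\ -S_n^{T} & 0\end{pmatrix},\qquad B_i=\begin{pmatrix}0 & T_n\\ -T_n^{T} & 0\end{pmatrix},$$ where $S_n=(E_n\mid 0)$ and $T_n=(0\mid E_n)$ are the $n\times(n+1)$ matrices obtained by appending a zero column to $E_n$ on the right, respectively on the left. For $n=0$, $A_i$ and $B_i$ are both the $1\times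 1$ zero matrix.
   Context: The matrix of a bilinear form $A$ in a basis $b_1,\dots,b_N$ has $(p,q)$ entry $A(b_p,b_q)$. $E_n$ denotes the $n\times n$ identity matrix, and $J_n(\lambda)$ denotes the $n\times n$ upper triangular Jordan matrix with $\lambda$ on the diagonal, $1$ on the superdiagonal, and zeros elsewhere. The diagonal zero blocks in cases 1 and 2 have size $n\times n$; in case 3 the upper left zero block has size $n\times n$ and the lower right one has size $(n+1)\times(n+1)$. Different blocks may have different sizes, types and eigenvalues. *)

(* Defs.v *)
From HB Require Import structures.
From mathcomp Require Import all_boot all_order all_algebra.

Set Implicit Arguments.
Unset Strict Implicit.
Unset Printing Implicit Defensive.

Import GRing.Theory.
Local Open Scope ring_scope.

Definition gram_mx (K : fieldType) (V : vectType K) (f : V -> V -> K)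
    (N : nat) (b : N.-tuple V) : 'M[K]_N :=
  \matrix_(p, q) f (tnth b p) (tnth b q).

Definition jordan_mx (K : fieldType) (n : nat) (lambda : K) : 'M[K]_n :=
  \matrix_(i, j) (if j == i then lambda
                  else if (j == i.+1 :> nat) then 1 else 0).

(* (E_n | 0), of size n x (n + 1); the cast only turns n + 1 into n.+1. *)
Definition kronS (K : fieldType) (n : nat) : 'M[K]_(n, n.+1) :=
  castmx (erefl n, addn1 n) (row_mx 1%:M (0 : 'cV_n)).

(* (0 | E_n), of size n x (n + 1). *)
Definition kronT (K : fieldType) (n : nat) : 'M[K]_(n, n.+1) :=
  row_mx (0 : 'cV_n) 1%:M.

Definition skew_block (K : fieldType) (p q : nat) (M : 'M[K]_(p, q)) :
    'M[K]_(p + q) :=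
  block_mx 0 M (- M^T) 0.

Inductive canonical_pair (K : fieldType) :
    forall m : nat, 'M[K]_m -> 'M[K]_m -> Prop :=
| JordanPair (n : nat) (lambda : K) : (1 <= n)%N ->
    canonical_pair (skew_block (jordan_mx n lambda))
                   (skew_block (1%:M : 'M[K]_n))
| JordanInftyPair (n : nat) : (1 <= n)%N ->
    canonical_pair (skew_block (1%:M : 'M[K]_n))
                   (skew_block (jordan_mx n (0 : K)))
| KroneckerPair (n : nat) :
    canonical_pair (skew_block (kronS K n)) (skew_block (kronT K n)).

(* Main.v *)
Require Import Defs.
From HB Require Import structures.
From mathcomp Require Import all_boot all_order all_algebra.

Set Implicit Arguments.
Unset Strict Implicit.
Unset Printing Implicit Defensive.

Import GRing.Theory.
Local Open Scope ring_scope.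

(* By strong induction on the dimension it suffices to split off one canonical
   block, orthogonally for both forms.

   If det (B - tA) is not identically 0, some A - mu B is invertible, and
   P = B (A - mu B)^-1 is self-adjoint for both forms. The Fitting decomposition
   ker P^k + im P^k is orthogonal for both, so P may be assumed nilpotent or
   invertible; repeating this with A B^-1 - nu (nu an eigenvalue) or B A^-1
   leaves a nilpotent self-adjoint operator P of index n. Choosing v, w with
   (v P^k, w) = [k = n - 1], the vectors v P^i and w P^(n-1-j) span a Jordan
   block, whose orthogonal complement splits off.

   If det (B - tA) = 0, there is a chain v_0, ..., v_n with v_0 B = 0,
   v_(i+1) B = v_i A =: phi_i, v_n A = 0; take n minimal. Minimality makes the
   v_i and the phi_i independent, and also shows, by linear duality, that there
   are w_0, ..., w_(n-1) with (w_i, phi_j) = - [i = j] and w_i B = w_(i+1) A. In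
   both families the Gram matrices are Hankel and skew-symmetric, hence 0, so
   the w_i and v_j span a Kronecker block. The functionals v_i A, v_i B, w_i A
   and w_i B span only dimension 2n + 1, so their common kernel is a
   complement. *)

(** * Splitting off an orthogonal block *)

Lemma eq_oppr_eq0 (K : fieldType) (x : K) :
  2%N \notin [pchar K] -> x = - x -> x = 0.
Proof.
move=> char2 /eqP; rewrite -addr_eq0 -mulr2n -mulr_natr mulf_eq0.
move=> /orP[/eqP//|/eqP e2]; case/negP: char2.
by rewrite inE /= e2 eqxx.
Qed.

Lemma mx11_eq0 (K : fieldType) (x : 'M[K]_1) : 2%N \notin [pchar K] ->
  x^T = - x -> x = 0.
Proof.
move=> char2 xT; apply/matrixP=> i j; rewrite !ord1 mxE.
by apply: eq_oppr_eq0 => //; move/matrixP: xT => /(_ 0 0); rewrite !mxE.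
Qed.

(** Vectors are rows. Spanning together with [m + r = N] makes the rows of [P1] and [P2] a basis;
    for skew-symmetric forms, orthogonality in the other order is automatic. *)
Definition splits (K : fieldType) N (A B : 'M[K]_N) :=
  exists m (A1 B1 : 'M[K]_m) (P1 : 'M[K]_(m, N)) r (P2 : 'M[K]_(r, N)),
  [/\ canonical_pair A1 B1, (m + r = N)%N, (1%:M <= P1 + P2)%MS,
      P1 *m A *m P1^T = A1 /\ P1 *m B *m P1^T = B1
    & P1 *m A *m P2^T = 0 /\ P1 *m B *m P2^T = 0].

(** The columns of [D] are functionals generating all rows of [P1 *m A] and [P1 *m B], so their
    common kernel is orthogonal to the block for both forms. Freeness of [P1 *m D] makes this kernel
    meet the block trivially, and the rank bound gives it the complementary dimension. *)
Lemma splits_kermx (K : fieldType) N (A B : 'M[K]_N) m (A1 B1 : 'M[K]_m)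
    (P1 : 'M[K]_(m, N)) c (D : 'M[K]_(N, c)) (MA MB : 'M[K]_(m, c)) :
  canonical_pair A1 B1 -> P1 *m A *m P1^T = A1 -> P1 *m B *m P1^T = B1 ->
  row_free (P1 *m D) -> (\rank D <= m)%N ->
  P1 *m A = MA *m D^T -> P1 *m B = MB *m D^T -> splits A B.
Proof.
move=> can1 eA1 eB1 freeD rkD eMA eMB.
have rkD' : \rank D = m.
  apply/eqP; rewrite eqn_leq rkD /= -{1}(eqP freeD).
  exact: mxrankM_maxr.
pose P2 := row_base (kermx D).
have P2D : P2 *m D = 0 by apply/sub_kermxP; rewrite eq_row_base.
exists m, A1, B1, P1, (\rank (kermx D)), P2; split=> //.
- by rewrite mxrank_ker rkD' subnKC // -rkD' rank_leq_row.
- have P1f : row_free P1 by rewrite /row_free eqn_leq rank_leq_row /=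
     -{1}(eqP freeD) mxrankM_maxl.
  have cap0 : (P1 :&: P2)%MS = 0.
    apply/eqP/rowV0P => v; rewrite sub_capmx => /andP[/submxP[u ->]].
    move=> /submxP[w uP]; have : u *m (P1 *m D) = 0.
      by rewrite mulmxA uP -mulmxA P2D mulmx0.
    by move/eqP; rewrite mulmx_free_eq0 // => /eqP->; rewrite mul0mx.
  rewrite sub1mx /row_full mxrank_disjoint_sum // (eqP P1f).
  rewrite eq_row_base mxrank_ker rkD' subnKC // -rkD'; exact: rank_leq_row.
- by rewrite eMA eMB -!mulmxA -!trmx_mul P2D trmx0 !mulmx0.
Qed.

Lemma splits_sum (K : fieldType) N (A B : 'M[K]_N) a b
    (U : 'M[K]_(a, N)) (W : 'M[K]_(b, N)) :
  (a + b = N)%N -> (1%:M <= U + W)%MS ->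
  U *m A *m W^T = 0 -> U *m B *m W^T = 0 ->
  splits (U *m A *m U^T) (U *m B *m U^T) -> splits A B.
Proof.
move=> abN full UAW UBW [m [A1 [B1 [P1 [r [P2 [can1 mra fullP]]]]]]].
rewrite !mulmxA => -[eA1 eB1] [oA oB].
(* The new complement joins the complement of the block inside [U] with all of [W]. *)
exists m, A1, B1, (P1 *m U), (r + b)%N, (col_mx (P2 *m U) W).
rewrite !trmx_mul !mulmxA; split=> //; first by rewrite addnA mra.
- apply: (submx_trans full); rewrite addsmx_sub; apply/andP; split.
    rewrite -[X in (X <= _)%MS]mul1mx; apply: (submx_trans (submxMr U fullP)).
    rewrite addsmxMr addsmxS // -addsmxE; exact: addsmxSl.
  by apply: submx_trans (addsmxSr _ _); rewrite -addsmxE; apply: addsmxSr.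
- rewrite !tr_col_mx !mul_mx_row !trmx_mul !mulmxA oA oB -!(mulmxA P1).
  by rewrite UAW UBW !mulmx0 row_mx0.
Qed.

(** * Jordan blocks *)

Lemma gram_rowE (K : fieldType) m n p q (E : 'M[K]_(m, p)) (X : 'M[K]_(p, q))
    (F : 'M[K]_(n, q)) i j :
  (E *m X *m F^T) i j = (row i E *m X *m (row j F)^T) 0 0.
Proof. by rewrite -row_mul !mxE; apply: eq_bigr => k _; rewrite !mxE. Qed.

Lemma gram_col_mx (K : fieldType) N (A : 'M[K]_N) p q (E : 'M[K]_(p, N))
    (F : 'M[K]_(q, N)) (M : 'M[K]_(p, q)) :
  A^T = - A -> E *m A *m E^T = 0 -> F *m A *m F^T = 0 -> E *m A *m F^T = M ->
  col_mx E F *m A *m (col_mx E F)^T = skew_block M.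
Proof.
move=> skA EE FF EF.
rewrite tr_col_mx mul_col_mx mul_col_row EE FF EF; congr block_mx.
by rewrite -EF !trmx_mul trmxK skA mulNmx mulmxN opprK mulmxA.
Qed.

Section SelfAdjoint.
Variables (K : fieldType) (N : nat) (B P : 'M[K]_N).
Hypothesis PB : P *m B = B *m P^T.

Lemma mulmx_exp_adj k : P ^+ k *m B = B *m (P ^+ k)^T.
Proof.
elim: k => [|k IH]; first by rewrite !expr0 trmx1 mulmx1 mul1mx.
rewrite exprS -mulmxE -mulmxA IH mulmxA PB -mulmxA -trmx_mul.
by rewrite !mulmxE -exprSr -exprS.
Qed.

Lemma gram_exp_adj m n (x : 'M_(m, N)) (y : 'M_(n, N)) i j k :
  (x *m P ^+ i) *m (P ^+ k *m B) *m (y *m P ^+ j)^T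
  = x *m P ^+ (i + k + j) *m B *m y^T.
Proof.
rewrite trmx_mul !mulmxA -(mulmxA _ B) -mulmx_exp_adj !mulmxA.
by rewrite !exprD -!mulmxE !mulmxA.
Qed.

(** Self-adjointness of [P] makes [P ^+ k *m B] skew-symmetric again, hence alternating outside
    characteristic 2. *)
Lemma gram_exp_alt (x : 'rV_N) k : 2%N \notin [pchar K] -> B^T = - B ->
  x *m P ^+ k *m B *m x^T = 0.
Proof.
move=> char2 skB; apply: mx11_eq0 => //.
rewrite !trmx_mul trmxK skB mulNmx mulmxN mulmxA -!mulmxA.
by congr (- (_ *m _)); rewrite !mulmxA mulmx_exp_adj.
Qed.

End SelfAdjoint.

(** The last conclusion says that the span of the block is stable under [P]; since [A = P *m B], one
    orthogonal complement will then serve both forms. *)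
Lemma nilpotent_chain_block (K : fieldType) N (A B P : 'M[K]_N) k :
  2%N \notin [pchar K] -> B^T = - B -> B \in unitmx -> (0 < N)%N ->
  P *m B = B *m P^T -> P *m B = A -> P ^+ k = 0 ->
  exists n (P1 : 'M[K]_(n + n, N)) (M : 'M[K]_(n + n)),
  [/\ (0 < n)%N, P1 *m A *m P1^T = skew_block (jordan_mx n 0),
      P1 *m B *m P1^T = skew_block 1%:M & P1 *m P = M *m P1].
Proof.
move=> char2 skB uB N0 PB defA Pk0.
have [n] : {n | P ^+ n == 0 & forall m, P ^+ m == 0 -> (n <= m)%N}.
  have ex0 : exists n, P ^+ n == 0 by exists k; rewrite Pk0.
  by exists (ex_minn ex0); case: ex_minnP.
case: n => [|n].
  rewrite expr0 => /eqP/matrixP/(_ (Ordinal N0) (Ordinal N0))/eqP.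
  by rewrite !mxE eqxx oner_eq0.
move=> /eqP Pn0 minP.
have Pge m : (n < m)%N -> P ^+ m = 0.
  by move=> /subnK <-; rewrite exprD Pn0 mulr0.
have {minP} Pn : P ^+ n != 0 by apply/negP=> /minP; rewrite ltnn.
have [i0 vPn] : exists i, row i (P ^+ n) != 0.
  apply/existsP; apply: contraNT Pn; rewrite negb_exists => /forallP P0.
  apply/eqP/row_matrixP => i; rewrite row0; apply/eqP; exact: negbNE (P0 i).
pose v : 'rV[K]_N := delta_mx 0 i0.
rewrite rowE -/v in vPn.
pose E : 'M_(n.+1, N) := \matrix_(i < n.+1) (v *m P ^+ i).
(* If the coefficients before index i of a relation vanish, applying [P ^+ (n - i)] kills all later
   terms and leaves the i-th coefficient times [v *m P ^+ n]. *)
have freeE : row_free E.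
  apply: inj_row_free => u uE0; apply/rowP => i; rewrite mxE.
  case: i => i; elim/ltn_ind: i => i IH lt_in.
  have : u *m E *m P ^+ (n - i) = 0 by rewrite uE0 mul0mx.
  rewrite (mulmx_sum_row u) mulmx_suml (bigD1 (Ordinal lt_in)) //=.
  rewrite big1 => [|j ne_ji].
    rewrite addr0 rowK -scalemxAl -mulmxA mulmxE -exprD subnKC //.
    by move/eqP; rewrite scalemx_eq0 (negPf vPn) orbF => /eqP.
  rewrite rowK -scalemxAl -mulmxA mulmxE -exprD.
  have le_in : (i <= n)%N by rewrite -ltnS.
  case: (ltngtP j i) => [lt_ji|lt_ij|e_ij].
  - rewrite (_ : u 0 j = 0) ?scale0r //; have := IH j lt_ji (ltn_ord j).
    by rewrite (_ : Ordinal _ = j) //; apply: val_inj.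
  - by rewrite Pge ?mulmx0 ?scaler0 // addnBA // ltn_subRL ltn_add2r.
  - by case/eqP: ne_ji; apply: val_inj.
(* As [B] is invertible, the functionals [v *m P ^+ i *m B] are independent; the last column of a
   right inverse is the vector [w] pairing to 1 with [v *m P ^+ n] and to 0 with the lower
   powers. *)
have /row_freeP[R EBR] : row_free (E *m B).
  by rewrite /row_free mxrankMfree // row_free_unit.
pose w := (col ord_max R)^T.
have cE m : v *m P ^+ m *m B *m w^T = (m == n)%:R%:M.
  case: (ltnP m n.+1) => [lt_mn|lt_nm]; last first.
    by rewrite Pge // mulmx0 !mul0mx gtn_eqF // -scalemx1 scale0r.
  have <- : row (Ordinal lt_mn) E = v *m P ^+ m by rewrite rowK.
  rewrite /w trmxK -row_mul; apply/matrixP=> a b; rewrite !ord1 {a b}.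
  have /matrixP/(_ (Ordinal lt_mn) ord_max) := EBR.
  rewrite [LHS]mxE [RHS]mxE [RHS in _ -> _ = RHS]mxE /= => <-.
  by rewrite [LHS]mxE; apply: eq_bigr => z _;
    rewrite [row _ _ _ _]mxE [col _ _ _ _]mxE.
(* The reversed order of exponents makes [F] dual to [E] under [B]: the exponents add up to n
   exactly when i = j. *)
pose F : 'M_(n.+1, N) := \matrix_(j < n.+1) (w *m P ^+ (n - j)).
exists n.+1, (col_mx E F).
have stab : (col_mx E F *m P <= col_mx E F)%MS.
  rewrite mul_col_mx col_mx_sub; apply/andP; split; apply/row_subP => i.
    rewrite row_mul rowK -mulmxA mulmxE -exprSr.
    case: (ltnP i.+1 n.+1) => [lt_in|/Pge->]; last by rewrite mulmx0 sub0mx.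
    rewrite -addsmxE; apply: (submx_trans _ (addsmxSl E F)).
    by apply: (eq_row_sub (Ordinal lt_in)); rewrite rowK.
  rewrite row_mul rowK -mulmxA mulmxE -exprSr.
  case: (posnP i) => [->|i_gt0]; first by rewrite subn0 Pge // mulmx0 sub0mx.
  rewrite -addsmxE; apply: (submx_trans _ (addsmxSr E F)).
  have lt_in : (i.-1 < n.+1)%N by rewrite prednK // ltnW.
  apply: (eq_row_sub (Ordinal lt_in)); rewrite rowK /=.
  have le_in : (i <= n)%N by rewrite -ltnS.
  by rewrite -subSn // -{2}(prednK i_gt0) subSS.
have [M eM] := submxP stab; exists M.
have EE m : E *m (P ^+ m *m B) *m E^T = 0.
  apply/matrixP=> i j; rewrite gram_rowE !rowK gram_exp_adj //.
  by rewrite gram_exp_alt // !mxE.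
have FF m : F *m (P ^+ m *m B) *m F^T = 0.
  apply/matrixP=> i j; rewrite gram_rowE !rowK gram_exp_adj //.
  by rewrite gram_exp_alt // !mxE.
have EF m (i j : 'I_n.+1) :
    (E *m (P ^+ m *m B) *m F^T) i j = (j == (i + m)%N :> nat)%:R.
  rewrite gram_rowE !rowK gram_exp_adj // cE mxE eqxx mulr1n.
  have le_jn : (j <= n)%N by rewrite -ltnS.
  congr (_%:R); rewrite addnBA // -(eqn_add2r j) subnK; last first.
    by rewrite (leq_trans (_ : j <= n)%N) ?leq_addl // -ltnS.
  by rewrite [(n + j)%N]addnC eqn_add2r eq_sym.
have skA : A^T = - A by rewrite -defA trmx_mul skB mulNmx PB.
split=> //.
- apply: gram_col_mx => //; rewrite -defA -[P]expr1;
    [exact: EE | exact: FF |].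
  apply/matrixP=> i j; rewrite EF !mxE addn1.
  by case: (eqVneq j i) => [->|_]; [rewrite ltn_eqF | case: (_ == _)].
- have B0 : B = P ^+ 0 *m B by rewrite expr0 mul1mx.
  apply: gram_col_mx => //; rewrite B0; [exact: EE | exact: FF |].
  by apply/matrixP=> i j; rewrite EF !mxE addn0 eq_sym.
Qed.

(** Doubling the exponent strictly lowers the rank until it is stable. Positivity of [k] excludes
    the trivial solution [P ^+ 0]. *)
Lemma exp_rank_stable (K : fieldType) N (P : 'M[K]_N) :
  exists2 k, (0 < k)%N & \rank (P ^+ k *m P ^+ k) = \rank (P ^+ k).
Proof.
suff stable r k : (0 < k)%N -> (\rank (P ^+ k) <= r)%N ->
    exists2 k, (0 < k)%N & \rank (P ^+ k *m P ^+ k) = \rank (P ^+ k).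
  exact: (stable N 1%N isT (rank_leq_row _)).
elim: r k => [|r IH] k k_gt0 rk.
  exists k => //; move: rk; rewrite leqn0 mxrank_eq0 => /eqP->.
  by rewrite mul0mx.
have [eq_rk|ne_rk] := eqVneq (\rank (P ^+ k *m P ^+ k)) (\rank (P ^+ k)).
  by exists k.
apply: (IH (k + k)%N); first by rewrite addn_gt0 k_gt0.
rewrite exprD -mulmxE -ltnS (leq_trans _ rk) // ltn_neqAle ne_rk /=.
exact: mxrankM_maxl.
Qed.

Definition splits_below (K : fieldType) N := forall M (A B : 'M[K]_M),
  (0 < M < N)%N -> A^T = - A -> B^T = - B -> splits A B.

Lemma skew_gram (K : fieldType) m n (A : 'M[K]_n) (U : 'M[K]_(m, n)) :
  A^T = - A -> (U *m A *m U^T)^T = - (U *m A *m U^T).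
Proof. by move=> skA; rewrite !trmx_mul trmxK skA mulNmx mulmxN mulmxA. Qed.

(** If u is killed by [Q = P ^+ k], then u is orthogonal to every x Q, because Q moves across both
    forms. When kernel and image are both nonzero, induction finds a block inside the kernel. *)
Lemma fitting_splits (K : fieldType) N (A B P : 'M[K]_N) :
  splits_below K N -> A^T = - A -> B^T = - B ->
  P *m A = A *m P^T -> P *m B = B *m P^T ->
  [\/ P \in unitmx, exists k, P ^+ k = 0 | splits A B].
Proof.
move=> IH skA skB PA PB.
have [k k_gt0 stable] := exp_rank_stable P; set Q := P ^+ k in stable.
have [rk0|rk_gt0] := posnP (\rank Q).
  by constructor 2; exists k; apply/eqP; rewrite -mxrank_eq0 rk0.
have [rkN|rk_ltN] := eqVneq (\rank Q) N.
  constructor 1; rewrite -row_free_unit /row_free eqn_leq rank_leq_row /=.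
  rewrite -{1}rkN /Q -(prednK k_gt0) exprSr; exact: mxrankM_maxr.
have {}rk_ltN : (\rank Q < N)%N by rewrite ltn_neqAle rk_ltN rank_leq_row.
constructor 3.
pose U := row_base (kermx Q); pose W := row_base Q.
have UQ : U *m Q = 0 by apply/sub_kermxP; rewrite eq_row_base.
have [X eW] : exists X, W = X *m Q by apply/submxP; rewrite eq_row_base.
have orth Y : P *m Y = Y *m P^T -> U *m Y *m W^T = 0.
  move=> PY; rewrite eW trmx_mul mulmxA -(mulmxA U) -(mulmx_exp_adj PY).
  by rewrite mulmxA UQ !mul0mx.
apply: (@splits_sum _ _ _ _ _ _ U W); rewrite ?orth //.
- by rewrite mxrank_ker subnK // ltnW.
(* The rank of [Q *m Q] plus the dimension of this intersection is the rank of [Q], so stability of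
   the rank forces the intersection to vanish. *)
- have cap0 : (Q :&: kermx Q)%MS = 0.
    apply/eqP; rewrite -mxrank_eq0 -(eqn_add2l (\rank (Q *m Q))) addn0.
    by rewrite mxrank_mul_ker stable.
  rewrite sub1mx /row_full addsmxC mxrank_disjoint_sum; last first.
    by apply/eqP; rewrite -submx0 -cap0 capmxS ?eq_row_base.
  by rewrite !eq_row_base mxrank_ker subnKC // ltnW.
- apply: IH; rewrite ?skew_gram // mxrank_ker subn_gt0 rk_ltN /=.
  by rewrite ltn_subrL rk_gt0 (leq_ltn_trans _ rk_ltN).
Qed.

Lemma skew_block_jordan (K : fieldType) n (x : K) :
  skew_block (jordan_mx n 0) + x *: skew_block 1%:M = skew_block (jordan_mx n x).
Proof.
have e : jordan_mx n 0 + x *: 1%:M = jordan_mx n x.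
  apply/matrixP=> i j; rewrite !mxE [i == j]eq_sym.
  case: (eqVneq j i) => _; first by rewrite add0r mulr1.
  by rewrite mulr0 addr0.
rewrite /skew_block scale_block_mx add_block_mx !scaler0 !addr0 e.
by rewrite scalerN -opprD -linearZ -linearD /= e.
Qed.

Lemma skew_block1_free (K : fieldType) n :
  row_free (skew_block (1%:M : 'M[K]_n)).
Proof.
apply/row_freeP; exists (- skew_block 1%:M).
rewrite /skew_block opp_block_mx mulmx_block trmx1 !oppr0 opprK.
by rewrite !(mul0mx, mulmx0, mulNmx, mulmxN, mul1mx, addr0, add0r) opprK
  -scalar_mx_block.
Qed.

(** Stability gives [P1 *m (P *m B) = M *m P1 *m B], so the functionals [P1 *m B] alone cut out the
    complement for both forms. Adding [x *: B] moves the eigenvalue from 0 to [x]; exchanging the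
    two forms gives the block at infinity. *)
Lemma nilpotent_splits (K : fieldType) N (B P : 'M[K]_N) k :
  2%N \notin [pchar K] -> B^T = - B -> B \in unitmx -> (0 < N)%N ->
  P *m B = B *m P^T -> P ^+ k = 0 ->
  (forall x, splits (P *m B + x *: B) B) /\ splits B (P *m B).
Proof.
move=> char2 skB uB N_gt0 PB Pk0.
have [n [P1 [M [n_gt0 eA eB eM]]]] :=
  nilpotent_chain_block char2 skB uB N_gt0 PB erefl Pk0.
have DT : (B *m P1^T)^T = - (P1 *m B) by rewrite trmx_mul trmxK skB mulmxN.
have rkD : (\rank (B *m P1^T) <= n + n)%N := rank_leq_col _.
have freeD : row_free (P1 *m (B *m P1^T)).
  by rewrite mulmxA eB skew_block1_free.
have PA : P1 *m (P *m B) = - M *m (B *m P1^T)^T.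
  by rewrite DT mulmxN mulNmx opprK !mulmxA eM.
have PB1 : P1 *m B = - 1%:M *m (B *m P1^T)^T.
  by rewrite DT mulmxN mulNmx opprK mul1mx.
split=> [x|]; last first.
  exact: (splits_kermx (JordanInftyPair K n_gt0) eB eA freeD rkD PB1 PA).
apply: (splits_kermx (JordanPair x n_gt0) _ eB freeD rkD _ PB1).
  by rewrite mulmxDr mulmxDl eA -scalemxAr -scalemxAl eB skew_block_jordan.
by rewrite mulmxDr PA -scalemxAr PB1 scalemxAl -mulmxDl.
Qed.

Lemma regular_splits (K : closedFieldType) N (A B : 'M[K]_N) mu :
  2%N \notin [pchar K] -> (0 < N)%N -> splits_below K N ->
  A^T = - A -> B^T = - B -> A - mu *: B \in unitmx -> splits A B.
Proof.
move=> char2 N_gt0 IH skA skB; set C := A - mu *: B => uC.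
have skC : C^T = - C by rewrite /C linearB linearZ /= skA skB scalerN opprD.
pose P := B *m invmx C.
have PC : P *m C = B by rewrite mulmxKV.
have adj (X Y Q : 'M[K]_N) : X^T = - X -> Y^T = - Y -> Q *m Y = X -> X = Y *m Q^T.
  by move=> skX skY QY; rewrite -[LHS]opprK -skX -QY trmx_mul skY mulNmx opprK.
have PCT : B = C *m P^T by apply: (adj _ _ _ skB skC PC).
have PB : P *m B = B *m P^T by rewrite -{2}PC -mulmxA -PCT.
have eA : A = C + mu *: B by rewrite subrK.
have PA : P *m A = A *m P^T.
  by rewrite eA mulmxDr mulmxDl -scalemxAr -scalemxAl PB PC -PCT.
have [uP|[k Pk0]|//] := fitting_splits IH skA skB PA PB.
  have uB : B \in unitmx by rewrite -PC unitmx_mul uP.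
  pose Q := A *m invmx B.
  (* Algebraic closedness enters here: subtracting an eigenvalue makes [R] singular, which rules out
     the invertible case of [fitting_splits]. *)
  have [nu /eigenvalueP[v vQ v_neq0]] : exists nu, eigenvalue Q nu.
    have /closed_rootP[nu] : size (char_poly Q) != 1%N.
      by rewrite size_char_poly -(prednK N_gt0).
    by exists nu; rewrite eigenvalue_root_char.
  pose R := Q - nu%:M.
  have QB : Q *m B = A by rewrite mulmxKV.
  have QBT : A = B *m Q^T := adj _ _ _ skA skB QB.
  have eRB : R *m B = A - nu *: B by rewrite mulmxBl QB mul_scalar_mx.
  have RBT : R *m B = B *m R^T.
    by rewrite eRB linearB /= tr_scalar_mx mulmxBr -QBT mul_mx_scalar.
  have eA' : A = R *m B + nu *: B by rewrite eRB subrK.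
  have RA : R *m A = A *m R^T.
    rewrite eA' mulmxDr mulmxDl -scalemxAr -scalemxAl.
    by rewrite -[R *m B *m R^T]mulmxA -RBT.
  have [uR|[k Rk0]|//] := fitting_splits IH skA skB RA RBT.
    case/negP: v_neq0; have : v *m R = 0.
      by rewrite mulmxBr vQ mul_mx_scalar subrr.
    by move/(congr1 (mulmx^~ (invmx R))); rewrite mulmxK // mul0mx => ->.
  by rewrite eA'; have [] := nilpotent_splits char2 skB uB N_gt0 RBT Rk0.
(* Here [P] is nilpotent and [A = (1 + mu P) C]. A vector in the kernel of [1 + mu P] satisfies v =
   - mu v P; iterating this reaches [P ^+ k = 0]. *)
have uA : A \in unitmx.
  rewrite -row_free_unit; apply: inj_row_free => v.
  have -> : A = (1%:M + mu *: P) *m C.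
    by rewrite mulmxDl mul1mx -scalemxAl PC -eA.
  rewrite mulmxA => /(congr1 (mulmx^~ (invmx C))); rewrite mulmxK // mul0mx.
  rewrite mulmxDr mulmx1 => /eqP; rewrite addr_eq0 -scalemxAr -scaleNr => /eqP vP.
  have vPj j : v = (- mu) ^+ j *: (v *m P ^+ j).
    elim: j => [|j IHj]; first by rewrite !expr0 scale1r mulmx1.
    by rewrite {1}IHj {1}vP -scalemxAl scalerA -exprSr -mulmxA mulmxE -exprS.
  by rewrite (vPj k) Pk0 mulmx0 scaler0.
pose Q := B *m invmx A.
have QA : Q *m A = B by rewrite mulmxKV.
have QAT : B = A *m Q^T := adj _ _ _ skB skA QA.
have QB : Q *m B = B *m Q^T by rewrite -{2}QA -mulmxA -QAT.
have QA' : Q *m A = A *m Q^T by rewrite QA -QAT.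
(* An invertible [Q] would make [B], and with it the nilpotent [P], invertible, which is impossible
   for N > 0. *)
have [uQ|[j Qj0]|//] := fitting_splits IH skA skB QA' QB.
  have uP : P \in unitmx.
    have : B \in unitmx by rewrite -QA unitmx_mul uQ.
    by rewrite -PC unitmx_mul => /andP[].
  have : P ^+ k \in unitmx.
    elim: (k) => [|m uPm]; first by rewrite expr0 unitmx1.
    by rewrite exprS -mulmxE unitmx_mul uP.
  rewrite Pk0 -row_free_unit /row_free mxrank0 => /eqP N0.
  by rewrite -N0 in N_gt0.
by rewrite -QA; have [] := nilpotent_splits char2 skA uA N_gt0 QA' Qj0.
Qed.

(** * Kronecker blocks *)

Lemma kronSE (K : fieldType) n (i : 'I_n) (j : 'I_n.+1) :
  kronS K n i j = (j == i :> nat)%:R.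
Proof.
rewrite castmxE mxE cast_ord_id; case: splitP => k /= ->; rewrite !mxE //.
- by rewrite eq_sym.
- by rewrite ord1 addn0 gtn_eqF.
Qed.

Lemma kronTE (K : fieldType) n (i : 'I_n) (j : 'I_n.+1) :
  kronT K n i j = (j == i.+1 :> nat)%:R.
Proof.
rewrite mxE; case: (splitP (j : 'I_(1 + n))) => k /= ->; rewrite !mxE //.
- by rewrite ord1.
- by rewrite eqSS eq_sym.
Qed.

(** The default 0 past the last row lets the chain relations hold at every natural index; the
    terminal condition v_n A = 0 becomes an instance of them. *)
Definition rowz (K : fieldType) n N (X : 'M[K]_(n, N)) (i : nat) : 'rV[K]_N :=
  if insub i is Some j then row j X else 0.

Lemma rowz_ord (K : fieldType) n N (X : 'M[K]_(n, N)) (i : 'I_n) :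
  rowz X i = row i X.
Proof. by rewrite /rowz valK. Qed.

Lemma rowz_ge (K : fieldType) n N (X : 'M[K]_(n, N)) i :
  (n <= i)%N -> rowz X i = 0.
Proof. by move=> le_ni; rewrite /rowz insubN // -leqNgt. Qed.

Section KronRows.
Variables (K : fieldType) (n N : nat).

(** Left multiplication by [kronS] drops the last row and by [kronT] the first; their transposes
    append, respectively prepend, a zero row. *)
Lemma row_kronS (X : 'M[K]_(n.+1, N)) (i : 'I_n) :
  row i (kronS K n *m X) = rowz X i.
Proof.
rewrite (rowz_ord X (widen_ord (leqnSn n) i)) row_mul mulmx_sum_row.
rewrite (bigD1 (widen_ord (leqnSn n) i)) //= big1 => [|j ne_ji].
  by rewrite addr0 mxE kronSE eqxx scale1r.
by rewrite mxE kronSE (_ : (j == i :> nat) = false) ?scale0r //; apply: negPf.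
Qed.

Lemma row_kronT (X : 'M[K]_(n.+1, N)) (i : 'I_n) :
  row i (kronT K n *m X) = rowz X i.+1.
Proof.
rewrite (rowz_ord X (lift ord0 i)) row_mul mulmx_sum_row.
rewrite (bigD1 (lift ord0 i)) //= big1 => [|j ne_ji].
  by rewrite addr0 mxE kronTE eqxx scale1r.
by rewrite mxE kronTE (_ : (j == i.+1 :> nat) = false) ?scale0r //; apply: negPf.
Qed.

Lemma row_kronST (X : 'M[K]_(n, N)) (i : 'I_n.+1) :
  row i ((kronS K n)^T *m X) = rowz X i.
Proof.
rewrite row_mul mulmx_sum_row.
have [lt_in|le_ni] := ltnP i n.
  rewrite (rowz_ord X (Ordinal lt_in)) (bigD1 (Ordinal lt_in)) //=.
  rewrite big1 => [|j ne_ji]; first by rewrite addr0 !mxE kronSE eqxx scale1r.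
  by rewrite !mxE kronSE eq_sym (_ : (j == i :> nat) = false) ?scale0r //;
    apply: negPf.
rewrite rowz_ge // big1 // => j _; rewrite !mxE kronSE gtn_eqF ?scale0r //.
exact: leq_trans le_ni.
Qed.

Lemma row_kronTT (X : 'M[K]_(n, N)) (i : 'I_n.+1) :
  row i ((kronT K n)^T *m X) = if val i is i'.+1 then rowz X i' else 0.
Proof.
rewrite row_mul mulmx_sum_row; case: i => [[|i] lt_in] /=.
  by rewrite big1 // => j _; rewrite 2!mxE kronTE scale0r.
rewrite (rowz_ord X (Ordinal (lt_in : (i < n)%N))).
rewrite (bigD1 (Ordinal (lt_in : (i < n)%N))) //=.
rewrite big1 => [|j ne_ji]; first by rewrite addr0 2!mxE kronTE eqxx scale1r.
by rewrite 2!mxE kronTE eq_sym (_ : (j.+1 == i.+1 :> nat) = false) ?scale0r //;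
  apply: negPf.
Qed.

End KronRows.

Lemma rowz_mul (K : fieldType) n N p (X : 'M[K]_(n, N)) (Y : 'M[K]_(N, p)) i :
  rowz (X *m Y) i = rowz X i *m Y.
Proof.
have [lt_in|le_ni] := ltnP i n; last by rewrite !rowz_ge ?mul0mx.
by rewrite !(rowz_ord _ (Ordinal lt_in)) row_mul.
Qed.

Section Pencil.
Variables (K : fieldType) (N : nat) (A B : 'M[K]_N).

(* chain_defect X = 0 means that the polynomial \sum_i t^i x_i, where the x_i
   are the rows of X, is annihilated by B - t A. *)
Definition chain_defect n (X : 'M[K]_(n, N)) : 'M[K]_(n.+1, N) :=
  (kronS K n)^T *m X *m B - (kronT K n)^T *m X *m A.

Lemma chain_defect_rows n (X : 'M_(n, N)) :
  rowz X 0 *m B = 0 -> (forall i, rowz X i.+1 *m B = rowz X i *m A) ->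
  chain_defect X = 0.
Proof.
move=> X0 XS; apply/row_matrixP=> i; rewrite row0 linearB /= !(row_mul i (_ *m X)).
rewrite row_kronST row_kronTT; case: i => [[|i] lt_in] /=.
  by rewrite X0 mul0mx subrr.
by rewrite XS subrr.
Qed.

Lemma chain_defect_eq0 n (X : 'M_(n, N)) : chain_defect X = 0 ->
  rowz X 0 *m B = 0 /\ forall i, rowz X i.+1 *m B = rowz X i *m A.
Proof.
move=> X0; have X0r i : row i (chain_defect X) = 0 by rewrite X0 row0.
split=> [|i].
  have := X0r ord0; rewrite linearB /= !(row_mul _ (_ *m X)) row_kronST.
  by rewrite row_kronTT /= mul0mx subr0.
have [lt_in|le_ni] := ltnP i n; last by rewrite !rowz_ge ?mul0mx // ltnW.
have := X0r (Ordinal (lt_in : (i.+1 < n.+1)%N)).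
rewrite linearB /= !(row_mul _ (_ *m X)) row_kronST.
by rewrite row_kronTT /= => /eqP; rewrite subr_eq0 => /eqP.
Qed.

(** Write a and b for the Gram entries. Then a(i+1,j) = b(i,j) = - b(j,i) = - a(j+1,i) = a(i,j+1),
    so a depends only on i + j; being symmetric and skew-symmetric, it vanishes. *)
Lemma isotropic_chain n (W : 'M_(n.+1, N)) : 2%N \notin [pchar K] ->
  A^T = - A -> B^T = - B -> kronS K n *m W *m B = kronT K n *m W *m A ->
  W *m A *m W^T = 0 /\ W *m B *m W^T = 0.
Proof.
move=> char2 skA skB SWB; pose w i := rowz W i.
have wS i : (i < n)%N -> w i *m B = w i.+1 *m A.
  move=> lt_in; have /(congr1 (row (Ordinal lt_in))) := SWB.
  by rewrite !(row_mul _ (_ *m W)) row_kronS row_kronT.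
pose a i j := (w i *m A *m (w j)^T) 0 0; pose b i j := (w i *m B *m (w j)^T) 0 0.
have skew M i j : M^T = - M ->
    (w i *m M *m (w j)^T) 0 0 = - (w j *m M *m (w i)^T) 0 0.
  move=> skM; suff -> : w i *m M *m (w j)^T = - (w j *m M *m (w i)^T)^T.
    by rewrite !mxE.
  by rewrite !trmx_mul trmxK skM mulNmx mulmxN opprK mulmxA.
have shift i j : (i < n)%N -> (j < n)%N -> a i.+1 j = a i j.+1.
  move=> lt_in lt_jn; rewrite {1}/a -wS // skew // -/(b _ _) /b wS // -/(a _ _).
  by rewrite [RHS]skew.
have shiftn k i j : (i + k <= n)%N -> (j + k <= n)%N ->
    a (i + k)%N j = a i (j + k)%N.
  elim: k i j => [|k IH] i j; rewrite ?addn0 // !addnS => lt_in lt_jn.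
  rewrite -addSn IH ?addSn // 1?ltnW // shift //.
  by rewrite (leq_ltn_trans _ lt_in) // leq_addr.
have a0 i j : (i <= n)%N -> (j <= n)%N -> a i j = 0.
  move=> le_in le_jn; apply: eq_oppr_eq0 => //; rewrite -skew //.
  wlog le_ij : i j le_in le_jn / (i <= j)%N => [IH|].
    by case/orP: (leq_total i j) => ?; [|symmetry]; apply: IH.
  by rewrite -(subnKC le_ij) -/(a _ _) -/(a _ _) shiftn ?subnKC.
(* If one index is below n, the entry of b is up to sign an entry of a; the remaining b(n,n)
   vanishes by skew-symmetry. *)
have b0 i j : (i <= n)%N -> (j <= n)%N -> b i j = 0.
  have b0' k l : (k < n)%N -> (l <= n)%N -> b k l = 0.
    by move=> lt_kn le_ln; rewrite /b wS // -/(a _ _) a0.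
  rewrite leq_eqVlt => /orP[/eqP->|]; last exact: b0'.
  rewrite leq_eqVlt => /orP[/eqP->|lt_jn].
    by apply: eq_oppr_eq0 => //; rewrite -skew.
  by rewrite /b skew // -/(b _ _) b0' ?oppr0.
split; apply/matrixP=> i j; rewrite gram_rowE -!rowz_ord [RHS]mxE.
  by apply: a0; rewrite -ltnS.
by apply: b0; rewrite -ltnS.
Qed.

End Pencil.

(** * Linear duality for spaces of matrices *)

Section MatrixLinear.
Variables (K : fieldType) (m n p q : nat).
Implicit Type f : {linear 'M[K]_(m, n) -> 'M[K]_(p, q)}.

Lemma mx_linear_ker f : row_free (lin_mx f) \/ exists2 X, X != 0 & f X = 0.
Proof.
have [free|] := boolP (row_free (lin_mx f)); first by left.
rewrite -kermx_eq0 => /rowV0Pn[u /sub_kermxP uf0 u_neq0]; right.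
exists (vec_mx u); first by rewrite -mxvec_eq0 vec_mxK.
by rewrite -mx_rV_lin uf0 linear0.
Qed.

Lemma mx_linear_surj f : (m * n = p * q)%N -> (forall X, f X = 0 -> X = 0) ->
  forall Y, exists X, f X = Y.
Proof.
move=> dims inj_f Y; have [free|[X /negP X_neq0 fX0]] := mx_linear_ker f;
  last by case: X_neq0; apply/eqP/inj_f.
have full : row_full (lin_mx f) by rewrite /row_full (eqP free) dims.
have [u eu] := submxP (submx_full (mxvec Y) full).
exists (vec_mx u); apply: (can_inj mxvecK).
by rewrite -mul_vec_lin vec_mxK eu.
Qed.

End MatrixLinear.

Lemma mxtrace_mxvec (K : fieldType) m n (X Y : 'M[K]_(m, n)) :
  mxvec X *m (mxvec Y)^T = (\tr (X *m Y^T))%:M.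
Proof.
apply/matrixP=> i j; rewrite !ord1 !mxE eqxx mulr1n.
rewrite (reindex _ (curry_mxvec_bij m n)) /=.
under [RHS]eq_bigr => k do rewrite mxE.
rewrite pair_bigA; apply: eq_bigr => -[k l] _ /=.
by rewrite ![_^T _ _]mxE !mxvecE.
Qed.

Lemma mxtrace_eq0P (K : fieldType) m n (Y : 'M[K]_(n, m)) :
  (forall X : 'M_(m, n), \tr (X *m Y) = 0) -> Y = 0.
Proof.
move=> trY; apply/matrixP=> i j; rewrite [RHS]mxE -(trY (delta_mx j i)).
rewrite /mxtrace (bigD1 j) //= big1 => [|k ne_kj].
  rewrite addr0 mxE (bigD1 i) //= big1 => [|l ne_li].
    by rewrite addr0 mxE !eqxx mul1r.
  by rewrite mxE (negPf ne_li) andbF mul0r.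
by rewrite mxE big1 // => l _; rewrite mxE (negPf ne_kj) mul0r.
Qed.

Lemma col_mulmx (K : fieldType) m n p (X : 'M[K]_(m, n)) (Y : 'M[K]_(n, p)) i :
  col i (X *m Y) = X *m col i Y.
Proof. by rewrite !colE mulmxA. Qed.

(** A vector lies in the image of a linear map once every functional vanishing on the image vanishes
    on it. The cokernel supplies these functionals, which the trace pairing turns into pairs (Y,
    Z). *)
Lemma mx_fredholm (K : fieldType) m n p q p' q'
    (f : {linear 'M[K]_(m, n) -> 'M[K]_(p, q)})
    (g : {linear 'M[K]_(m, n) -> 'M[K]_(p', q')}) a b :
  (forall Y Z, (forall X, \tr (f X *m Y^T) + \tr (g X *m Z^T) = 0) ->
     \tr (a *m Y^T) + \tr (b *m Z^T) = 0) ->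
  exists X, f X = a /\ g X = b.
Proof.
move=> dual; pose M := row_mx (lin_mx f) (lin_mx g).
have : (row_mx (mxvec a) (mxvec b) <= M)%MS.
  rewrite submxE; apply/eqP/trmx_inj; rewrite trmx0; apply/row_matrixP => i.
  rewrite row0 -tr_col col_mulmx -[RHS]trmx0; congr _^T.
  set z := col i _; have Mz : M *m z = 0 by rewrite -col_mulmx mulmx_coker col0.
  have {Mz} : lin_mx f *m usubmx z + lin_mx g *m dsubmx z = 0.
    by rewrite -mul_row_col vsubmxK.
  rewrite -[z]vsubmxK; move: (usubmx z) (dsubmx z) => y z' /= Myz.
  rewrite mul_row_col.
  have [Y ey] : exists Y, y = (mxvec Y)^T.
    by exists (vec_mx y^T); rewrite vec_mxK trmxK.
  have [Z ez] : exists Z, z' = (mxvec Z)^T.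
    by exists (vec_mx z'^T); rewrite vec_mxK trmxK.
  rewrite ey ez {y z' ey ez} in Myz *.
  rewrite col_mxKu col_mxKd in Myz.
  rewrite !mxtrace_mxvec -raddfD dual ?raddf0 // => X.
  have := congr1 (mulmx (mxvec X)) Myz; rewrite mulmx0 mulmxDr !mulmxA.
  rewrite !mul_vec_lin !mxtrace_mxvec -raddfD.
  by move/matrixP/(_ 0 0); rewrite !mxE eqxx mulr1n.
case/submxP=> u; rewrite mul_mx_row => /eq_row_mx[ea eb].
exists (vec_mx u); split; apply: (can_inj mxvecK).
  by rewrite -mul_vec_lin vec_mxK ea.
by rewrite -mul_vec_lin vec_mxK eb.
Qed.

Lemma rowz_kronS (K : fieldType) n N (X : 'M[K]_(n.+1, N)) i :
  (i < n)%N -> rowz (kronS K n *m X) i = rowz X i.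
Proof. by move=> lt_in; rewrite (rowz_ord _ (Ordinal lt_in)) row_kronS. Qed.

Lemma rowz_kronT (K : fieldType) n N (X : 'M[K]_(n.+1, N)) i :
  rowz (kronT K n *m X) i = rowz X i.+1.
Proof.
have [lt_in|le_ni] := ltnP i n; last by rewrite !rowz_ge.
by rewrite (rowz_ord _ (Ordinal lt_in)) row_kronT.
Qed.

Lemma rowz0 (K : fieldType) n N i : rowz (0 : 'M[K]_(n, N)) i = 0.
Proof. by rewrite /rowz; case: insubP => // j _ _; rewrite row0. Qed.

Lemma rowz_eq0 (K : fieldType) n N (X : 'M[K]_(n, N)) :
  (forall i, rowz X i = 0) -> X = 0.
Proof. by move=> X0; apply/row_matrixP=> i; rewrite row0 -rowz_ord. Qed.

Lemma mul_kronS_tr (K : fieldType) n p (M : 'M[K]_(p, n.+1)) i j :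
  (M *m (kronS K n)^T) i j = M i (widen_ord (leqnSn n) j).
Proof.
have -> : M *m (kronS K n)^T = (kronS K n *m M^T)^T by rewrite trmx_mul trmxK.
have := row_kronS M^T j; rewrite (rowz_ord _ (widen_ord (leqnSn n) j)).
by move/rowP/(_ i); rewrite ![row _ _ _ _]mxE ![_^T _ _]mxE.
Qed.

Lemma mul_kronT_tr (K : fieldType) n p (M : 'M[K]_(p, n.+1)) i j :
  (M *m (kronT K n)^T) i j = M i (lift ord0 j).
Proof.
have -> : M *m (kronT K n)^T = (kronT K n *m M^T)^T by rewrite trmx_mul trmxK.
have := row_kronT M^T j; rewrite (rowz_ord _ (lift ord0 j)).
by move/rowP/(_ i); rewrite ![row _ _ _ _]mxE ![_^T _ _]mxE.
Qed.

(** Dropping the first and the last row commute. *)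
Lemma kronST_comm (K : fieldType) n :
  kronS K n *m kronT K n.+1 = kronT K n *m kronS K n.+1.
Proof.
apply/row_matrixP=> i; rewrite row_kronS row_kronT.
rewrite (rowz_ord _ (widen_ord (leqnSn n) i)) (rowz_ord _ (lift ord0 i)).
by apply/rowP=> j; rewrite ![row _ _ _ _]mxE kronSE kronTE.
Qed.

(** * Independence of a minimal chain *)

Section Singular.
Variables (K : fieldType) (N n : nat) (A B : 'M[K]_N) (L : 'M[K]_(n.+1, N)).
Hypothesis L_chain : chain_defect A B L = 0.
Hypothesis L_neq0 : L != 0.
(** Length exactly [n] is enough, since a shorter chain can be padded with zero rows. *)
Hypothesis L_min : forall X : 'M_(n, N), chain_defect A B X = 0 -> X = 0.

Let L0B : rowz L 0 *m B = 0 := proj1 (chain_defect_eq0 L_chain).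
Let LSB i : rowz L i.+1 *m B = rowz L i *m A.
Proof. exact: (proj2 (chain_defect_eq0 L_chain)). Qed.

Let Phi := kronS K n *m L *m A.

Lemma chain_mulA : L *m A = (kronS K n)^T *m Phi.
Proof.
apply/row_matrixP=> i; rewrite row_kronST row_mul -rowz_ord.
have [lt_in|le_ni] := ltnP i n; first by rewrite rowz_mul rowz_kronS.
by rewrite -LSB !rowz_ge ?mul0mx // ltnS.
Qed.

Lemma chain_mulB : L *m B = (kronT K n)^T *m Phi.
Proof.
apply/row_matrixP=> i; rewrite row_kronTT row_mul -rowz_ord.
case: i => [[|i] lt_in] //=.
by rewrite LSB rowz_mul rowz_kronS.
Qed.

(** If the first row were 0, dropping it would leave a chain with one row fewer. *)
Lemma chain_head_neq0 : rowz L 0 != 0.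
Proof.
apply: contraNneq L_neq0 => L0; apply/eqP.
suff TL0 : kronT K n *m L = 0.
  by apply: rowz_eq0 => -[|i] //; rewrite -rowz_kronT TL0 rowz0.
apply: L_min; apply: chain_defect_rows => [|i]; rewrite !rowz_kronT LSB //.
by rewrite L0 mul0mx.
Qed.

Lemma chain_image_free : row_free Phi.
Proof.
apply: inj_row_free => u uPhi0.
(* Since u *m Phi = 0, combining shifted copies of the chain with the
   coefficients of u gives a shorter chain. *)
pose M k : 'rV_N := if (k < n)%N then 0 else rowz L (k - n).
have MS k : M k.+1 *m B = M k *m A.
  rewrite /M; case: (ltngtP k.+1 n) => [lt_kn|le_nk|eq_kn].
  - by rewrite !mul0mx.
  - by rewrite subSn // LSB.
  - by rewrite (_ : k.+1 - n = 0)%N ?L0B ?mul0mx // eq_kn subnn.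
pose x i := \sum_(j < n) u 0 j *: M (j + i.+1)%N.
pose X : 'M_(n, N) := \matrix_(i < n) x i.
have rowzX i : (i < n)%N -> rowz X i = x i.
  by move=> lt_in; rewrite (rowz_ord _ (Ordinal lt_in)) rowK.
have xS i : x i.+1 *m B = x i *m A.
  rewrite !mulmx_suml; apply: eq_bigr => j _.
  by rewrite -!scalemxAl addnS MS.
have xn : x n.-1 *m A = 0.
  rewrite -[RHS]uPhi0 (mulmx_sum_row u) /x mulmx_suml; apply: eq_bigr => j _.
  have n_gt0 : (0 < n)%N := leq_ltn_trans (leq0n j) (ltn_ord j).
  rewrite prednK // -scalemxAl; congr (_ *: _).
  rewrite /M ltnNge leq_addl /= addnK -rowz_ord rowz_mul rowz_kronS //.
have X0 : X = 0.
  apply: L_min; apply: chain_defect_rows => [|i].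
    case: (posnP n) => [n0|n_gt0]; first by rewrite rowz_ge ?n0 ?mul0mx.
    rewrite rowzX // mulmx_suml big1 // => j _.
    by rewrite -scalemxAl addn1 MS /M ltn_ord mul0mx scaler0.
  case: (ltngtP i.+1 n) => [lt_in|le_ni|eq_in].
  - by rewrite !rowzX // ltnW.
  - by rewrite !rowz_ge ?mul0mx // ltnW.
  - rewrite rowz_ge ?eq_in // mul0mx rowzX ?eq_in // -?eq_in //.
    by rewrite -[i]/(i.+1.-1) eq_in xn.
have x0 i : (i < n)%N -> x i = 0 by move=> lt_in; rewrite -rowzX // X0 rowz0.
(* The coefficients vanish from the last one down: in x_k = 0, terms with j > n-1-k are gone by
   induction, those with j < n-1-k fall in the padding, and u_(n-1-k) v_0 remains. *)
apply/rowP => j; rewrite mxE -[j]rev_ordK; move: (rev_ord j) => {j} [k].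
elim/ltn_ind: k => k IH lt_kn.
have := x0 k lt_kn; rewrite /x (bigD1 (rev_ord (Ordinal lt_kn))) //= big1.
  rewrite addr0 /M subnK // ltnn subnn => /eqP.
  by rewrite scaler_eq0 (negPf chain_head_neq0) orbF => /eqP.
move=> j ne_j; case: (ltngtP (j + k.+1) n) => [lt_j|lt_j|eq_j].
- by rewrite /M lt_j scaler0.
- have lt_jk : (n - j.+1 < k)%N.
    by rewrite -(ltn_add2l j.+1) subnKC // addSn -addnS.
  have := IH _ lt_jk (ltn_trans lt_jk lt_kn).
  rewrite (_ : Ordinal _ = rev_ord j) ?rev_ordK; last exact: val_inj.
  by move=> ->; rewrite scale0r.
- by case/eqP: ne_j; apply: val_inj; rewrite /= -[LHS](addnK k.+1) eq_j.
Qed.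

(** Applying [B] to a relation gives a relation between the rows of [Phi], which kills all
    coefficients except that of the nonzero head. *)
Lemma chain_free : row_free L.
Proof.
apply: inj_row_free => d dL0.
have dT : d *m (kronT K n)^T = 0.
  have : d *m (kronT K n)^T *m Phi = 0
    by rewrite -mulmxA -chain_mulB mulmxA dL0 mul0mx.
  by move/eqP; rewrite (mulmx_free_eq0 _ chain_image_free) => /eqP.
have dS i : d 0 (lift ord0 i) = 0 by rewrite -mul_kronT_tr dT mxE.
have d0 : d 0 0 = 0.
  have := dL0; rewrite mulmx_sum_row big_ord_recl big1 => [|i _]; last first.
    by rewrite dS scale0r.
  rewrite addr0 -rowz_ord => /eqP.
  by rewrite scaler_eq0 (negPf chain_head_neq0) orbF => /eqP.
apply/rowP=> i; rewrite mxE; case: (unliftP ord0 i) => [j|] -> //.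
Qed.

End Singular.

(** * The dual chain *)

Section DualChain.
Variables (K : fieldType) (N n : nat) (A B : 'M[K]_N) (L : 'M[K]_(n.+2, N)).
Hypothesis L_chain : chain_defect A B L = 0.
Hypothesis L_neq0 : L != 0.
Hypothesis L_min : forall X : 'M_(n.+1, N), chain_defect A B X = 0 -> X = 0.

Let S := kronS K n.+1.
Let T := kronT K n.+1.
Let Phi := S *m L *m A.

(** This is the chain defect in coordinates: entry (i,j) is the diagonal difference C(i,j+1) -
    C(i-1,j), with zero rows outside the range. *)
Let h (C : 'M[K]_(n.+1, n.+2)) := S^T *m C *m T^T - T^T *m C *m S^T.

Lemma chain_defect_mul C : chain_defect A B (C *m L) = h C *m Phi.
Proof.
have eA : L *m A = S^T *m Phi := chain_mulA L_chain.
have eB : L *m B = T^T *m Phi := chain_mulB L_chain.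
rewrite /chain_defect /h mulmxBl.
by congr (_ - _); rewrite mulmxA -[LHS]mulmxA ?eA ?eB mulmxA.
Qed.

(** Source and target have equal dimension, and [h C = 0] makes [C *m L] a chain shorter than [L];
    it vanishes, and so does [C] because [L] is free. *)
Lemma toeplitz_surj Y : exists C, h C = Y.
Proof.
apply: (mx_linear_surj
  (f := (mulmxr T^T \o mulmx S^T) \- (mulmxr S^T \o mulmx T^T))).
  by rewrite mulnC.
move=> C hC0; apply/eqP.
rewrite -(mulmx_free_eq0 _ (chain_free L_chain L_neq0 L_min)).
by apply/eqP/L_min; rewrite chain_defect_mul [h C]hC0 mul0mx.
Qed.

(* By [mx_fredholm], the pairs (Q, Z) are the obstructions to solving for the
   dual chain W; subtracting a combination C *m L of the chain from Z with a
   zero row appended gives a chain shorter than L, which vanishes by minimality,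
   and then \tr Q telescopes to an entry of the last row of C, which is 0. *)
Lemma chain_trace0 (Q : 'M[K]_n.+1) (Z : 'M[K]_(n, N)) :
  Q *m Phi = chain_defect A B Z -> \tr Q = 0.
Proof.
move=> QPhi; have [C hC] := toeplitz_surj (S^T *m Q).
have CLZ : C *m L = (kronS K n)^T *m Z.
  apply/eqP; rewrite -subr_eq0; apply/eqP/L_min.
  have defectB X Y :
      chain_defect A B (X - Y) = chain_defect A B X - chain_defect A B Y.
    by rewrite /chain_defect !mulmxBr !mulmxBl opprD addrACA -opprD.
  rewrite defectB chain_defect_mul hC -mulmxA QPhi /chain_defect mulmxBr.
  rewrite !mulmxA -!trmx_mul kronST_comm.
  by rewrite subrr.
have Cn j : C ord_max j = 0.
  have : row ord_max C *m L = 0.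
    rewrite -row_mul CLZ row_kronST rowz_ge //.
  move/eqP; rewrite (mulmx_free_eq0 _ (chain_free L_chain L_neq0 L_min)).
  by move/eqP/rowP/(_ j); rewrite !mxE.
(* These are the superdiagonal entries of [C]; the diagonal of [h C = S^T *m Q] reads Q(i,i) = c_i -
   c_(i-1). *)
pose c k := rowz C k 0 (inord k.+1).
have Qii (i : 'I_n.+1) : Q i i = c i - (if val i is k.+1 then c k else 0).
  have -> : Q i i = (S^T *m Q) (widen_ord (leqnSn _) i) i.
    by have /rowP/(_ i) := row_kronST Q (widen_ord (leqnSn _) i);
      rewrite (rowz_ord Q i) !mxE.
  rewrite -hC /h [LHS]mxE [X in _ + X]mxE mul_kronT_tr mul_kronS_tr.
  congr (_ - _).
    have /rowP/(_ (lift ord0 i)) := row_kronST C (widen_ord (leqnSn _) i).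
    rewrite [row _ _ _ _]mxE => ->; congr (rowz C i 0 _).
    by apply: val_inj; rewrite /= inordK // ltnS.
  have /rowP/(_ (widen_ord (leqnSn _) i)) := row_kronTT C (widen_ord (leqnSn _) i).
  rewrite [row _ _ _ _]mxE => -> /=; case: i => [[|i] lt_in] /=.
    by rewrite mxE.
  by congr (rowz C i 0 _); apply: val_inj; rewrite /= inordK // ltnW.
rewrite /mxtrace (eq_bigr _ (fun i _ => Qii i)).
have telescope k : \sum_(i < k) (c i - (if val i is k.+1 then c k else 0))
    = if k is k'.+1 then c k' else 0.
  elim: k => [|k IH]; first by rewrite big_ord0.
  by rewrite big_ord_recr IH /= addrC subrK.
rewrite telescope /c (rowz_ord C ord_max) mxE; exact: Cn.
Qed.

Lemma dual_chain_exists : A^T = - A -> B^T = - B ->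
  exists W : 'M_(n.+1, N), W *m Phi^T = - 1%:M
    /\ kronS K n *m W *m B = kronT K n *m W *m A.
Proof.
move=> skA skB.
have [Q Z dual|W [W1 W2]] := @mx_fredholm K n.+1 N _ _ _ _ (mulmxr Phi^T)
  ((mulmxr B \o mulmx (kronS K n)) \- (mulmxr A \o mulmx (kronT K n)))
  (- 1%:M) 0; last first.
  by exists W; split=> //; apply/eqP; rewrite -subr_eq0; apply/eqP.
rewrite mul0mx raddf0 addr0 mulNmx mul1mx raddfN /= mxtrace_tr.
suff /chain_trace0-> : Q *m Phi = chain_defect A B Z by rewrite oppr0.
(* Orthogonality to all X becomes a matrix identity by nondegeneracy of the trace; transposing it
   and using skew-symmetry gives the hypothesis of [chain_trace0]. *)
have : Phi^T *m Q^T + (B *m Z^T *m kronS K n - A *m Z^T *m kronT K n) = 0.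
  apply: mxtrace_eq0P => X; rewrite -[RHS](dual X) mulmxDr raddfD /= mulmxA.
  congr (_ + _); rewrite mulmxBr mulmxBl !raddfB /= !mulmxA.
  rewrite [in LHS]mxtrace_mulC.
  rewrite [X in _ - X]mxtrace_mulC.
  by rewrite !mulmxA.
move/(congr1 trmx); rewrite linearD linearB /= !trmx_mul !trmxK trmx0 skA skB.
rewrite !mulmxN opprK => /eqP; rewrite addr_eq0 => /eqP->.
by rewrite /chain_defect !mulmxA opprD opprK.
Qed.

End DualChain.

(** Because w_i B = w_(i+1) A, the functionals w_i A and w_i B overlap in a single sequence psi_0,
    ..., psi_n, the rows of [Psi]. The sign in the first identity makes [Psi] dual to [L]. *)
Lemma kronecker_frame (K : fieldType) N n (A B : 'M[K]_N)
    (L : 'M[K]_(n.+1, N)) :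
  2%N \notin [pchar K] -> A^T = - A -> B^T = - B ->
  chain_defect A B L = 0 -> L != 0 ->
  (forall X : 'M_(n, N), chain_defect A B X = 0 -> X = 0) ->
  exists (W : 'M_(n, N)) (Psi : 'M_(n.+1, N)),
  [/\ W *m (kronS K n *m L *m A)^T = - 1%:M, Psi *m L^T = 1%:M,
      W *m A = kronS K n *m Psi /\ W *m B = kronT K n *m Psi,
      W *m A *m W^T = 0 & W *m B *m W^T = 0].
Proof.
move=> char2 skA skB L_chain L_neq0 L_min.
case: n => [|n] in L L_chain L_neq0 L_min *.
  (* For n = 0 there are no w_i, and any functional equal to 1 on the single vector of [L] serves as
     [Psi]. *)
  have /row_freeP[R LR] := chain_free L_chain L_neq0 L_min.
  exists 0, R^T; rewrite -trmx_mul LR trmx1 !mul0mx.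
  by split; rewrite ?[kronS K 0]flatmx0 ?[kronT K 0]flatmx0 ?mul0mx //;
    apply/matrixP=> -[].
have [W [WPhi SWB]] := dual_chain_exists L_chain L_neq0 L_min skA skB.
set Phi := _ *m L *m A in WPhi *.
have eA : L *m A = (kronS K n.+1)^T *m Phi := chain_mulA L_chain.
have eB : L *m B = (kronT K n.+1)^T *m Phi := chain_mulB L_chain.
have [isoA isoB] := isotropic_chain char2 skA skB SWB.
have WAL : W *m A *m L^T = kronS K n.+1.
  have -> : A = - A^T by rewrite skA opprK.
  rewrite mulmxN mulNmx -mulmxA -trmx_mul eA trmx_mul trmxK mulmxA WPhi.
  by rewrite mulNmx mul1mx opprK.
have WBL : W *m B *m L^T = kronT K n.+1.
  have -> : B = - B^T by rewrite skB opprK.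
  rewrite mulmxN mulNmx -mulmxA -trmx_mul eB trmx_mul trmxK mulmxA WPhi.
  by rewrite mulNmx mul1mx opprK.
pose Psi : 'M_(n.+2, N) := \matrix_(i < n.+2)
  (if (i < n.+1)%N then rowz (W *m A) i else rowz (W *m B) n).
have WA : W *m A = kronS K n.+1 *m Psi.
  apply/row_matrixP=> i; rewrite row_kronS -rowz_ord.
  by rewrite (rowz_ord Psi (widen_ord (leqnSn _) i)) rowK /= ltn_ord.
have WB : W *m B = kronT K n.+1 *m Psi.
  apply/row_matrixP=> i; rewrite row_kronT -rowz_ord.
  rewrite (rowz_ord Psi (lift ord0 i)) rowK /=.
  rewrite -[bump 0 i]/(i.+1) ltnS.
  case: (ltnP i n) => [lt_in|le_ni].
    rewrite !rowz_mul; have /(congr1 (row (Ordinal lt_in))) := SWB.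
    by rewrite !(row_mul _ (_ *m W)) row_kronS row_kronT.
  by congr (rowz _ _); apply/eqP; rewrite eqn_leq le_ni -ltnS ltn_ord.
exists W, Psi; split=> //.
apply/row_matrixP=> i; have [j ->|->] := unliftP ord0 i.
  have /(congr1 (row j)) : kronT K n.+1 *m (Psi *m L^T) = kronT K n.+1 *m 1%:M.
    by rewrite mulmxA -WB WBL mulmx1.
  by rewrite !row_kronT !(rowz_ord _ (lift ord0 j)).
have /(congr1 (row ord0)) : kronS K n.+1 *m (Psi *m L^T) = kronS K n.+1 *m 1%:M.
  by rewrite mulmxA -WA WAL mulmx1.
by rewrite !row_kronS !(rowz_ord _ (ord0 : 'I_n.+2)).
Qed.

(** The rows of [L *m A] and [L *m B] lie in the span of [Phi], those of [W *m A] and [W *m B] in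
    that of [Psi]. The pairing of (W, L) with (Phi, Psi) is block triangular with diagonal -1, 1, so
    [splits_kermx] applies. *)
Lemma singular_splits (K : fieldType) N n (A B : 'M[K]_N)
    (L : 'M[K]_(n.+1, N)) :
  2%N \notin [pchar K] -> A^T = - A -> B^T = - B ->
  chain_defect A B L = 0 -> L != 0 ->
  (forall X : 'M_(n, N), chain_defect A B X = 0 -> X = 0) -> splits A B.
Proof.
move=> char2 skA skB L_chain L_neq0 L_min.
have [W [Psi [WPhi PsiL [WA WB] isoA isoB]]] :=
  kronecker_frame char2 skA skB L_chain L_neq0 L_min.
set Phi := _ *m L *m A in WPhi.
have eA : L *m A = (kronS K n)^T *m Phi := chain_mulA L_chain.
have eB : L *m B = (kronT K n)^T *m Phi := chain_mulB L_chain.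
(* The chain [L] satisfies the shift relation with [A] and [B] exchanged, so [isotropic_chain] is
   applied with swapped forms. *)
have SLA : kronS K n *m L *m A = kronT K n *m L *m B.
  apply/row_matrixP=> i; rewrite !(row_mul _ (_ *m L)) row_kronS row_kronT.
  by have [_ ->] := chain_defect_eq0 L_chain.
have [LBL LAL] := isotropic_chain char2 skB skA SLA.
have LPhi : L *m Phi^T = 0.
  by rewrite /Phi !trmx_mul !mulmxA skA mulmxN !mulNmx LAL mul0mx oppr0.
have LPsi : L *m Psi^T = 1%:M.
  by apply: trmx_inj; rewrite trmx_mul trmxK PsiL trmx1.
pose D := (col_mx Phi Psi)^T.
apply: (@splits_kermx _ _ A B _ _ _ (col_mx W L) _ D
  (block_mx 0 (kronS K n) (kronS K n)^T 0)
  (block_mx 0 (kronT K n) (kronT K n)^T 0) (KroneckerPair K n)).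
- apply: gram_col_mx => //; rewrite WA -mulmxA PsiL; exact: mulmx1.
- apply: gram_col_mx => //; rewrite WB -mulmxA PsiL; exact: mulmx1.
- rewrite /D tr_col_mx mul_col_row WPhi LPhi LPsi; apply: inj_row_free => v.
  rewrite -[v]hsubmxK mul_row_block mulmxN !mulmx0 !mulmx1 addr0.
  rewrite -row_mx0 => /eq_row_mx[/eqP]; rewrite oppr_eq0 => /eqP->.
  by rewrite mul0mx add0r => ->.
- exact: rank_leq_col.
- by rewrite /D trmxK mul_col_mx WA eA mul_block_col !mul0mx add0r addr0.
- by rewrite /D trmxK mul_col_mx WB eB mul_block_col !mul0mx add0r addr0.
Qed.

Lemma minimal_chain (K : fieldType) N (A B : 'M[K]_N) n (X : 'M[K]_(n, N)) :
  chain_defect A B X = 0 -> X != 0 ->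
  exists m (L : 'M[K]_(m.+1, N)), [/\ chain_defect A B L = 0, L != 0 &
    forall Y : 'M_(m, N), chain_defect A B Y = 0 -> Y = 0].
Proof.
elim: n X => [|n IH] X XAB X_neq0.
  by case/eqP: X_neq0; apply: flatmx0.
pose f : {linear 'M[K]_(n, N) -> 'M[K]_(n.+1, N)} :=
  (mulmxr B \o mulmx (kronS K n)^T) \- (mulmxr A \o mulmx (kronT K n)^T).
have [free|[Y Y_neq0 Yf]] := mx_linear_ker f; last exact: IH Yf Y_neq0.
exists n, X; split=> // Y Yf; apply/eqP; rewrite -mxvec_eq0.
rewrite -(mulmx_free_eq0 _ free) mul_vec_lin mxvec_eq0; exact/eqP.
Qed.

(** A vanishing determinant gives a nonzero polynomial row vector killed by the pencil; its
    coefficient vectors are the rows of the chain, and [n] bounds their number. *)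
Lemma singular_chain (K : fieldType) N (A B : 'M[K]_N) :
  \det (map_mx polyC B - 'X *: map_mx polyC A) = 0 ->
  exists n (X : 'M[K]_(n, N)), chain_defect A B X = 0 /\ X != 0.
Proof.
move/eqP/det0P=> [v v_neq0 vBA].
pose n := \max_(j < N) size (v 0%R j).
pose X : 'M_(n, N) := \matrix_(i < n, j < N) (v 0 j)`_i.
have Xi i j : rowz X i 0 j = (v 0 j)`_i.
  have [lt_in|le_ni] := ltnP i n.
    by rewrite (rowz_ord _ (Ordinal lt_in)) !mxE.
  rewrite rowz_ge // mxE nth_default // (leq_trans _ le_ni) //.
  exact: (leq_bigmax j).
have vB j : \sum_k v 0 k * (B k j)%:P = 'X * \sum_k v 0 k * (A k j)%:P.
  have /rowP/(_ j) := vBA; rewrite [LHS]mxE [RHS]mxE => vBAj.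
  apply/eqP; rewrite -subr_eq0 -[X in _ == X]vBAj mulr_sumr -sumrB; apply/eqP.
  by apply: eq_bigr => k _; rewrite !mxE mulrBr mulrCA.
have coefsum (M : 'M[K]_N) i j :
    (\sum_k v 0 k * (M k j)%:P)`_i = (rowz X i *m M) 0 j.
  rewrite coef_sum mxE; apply: eq_bigr => k _.
  by rewrite coefMC Xi.
exists n, X; split.
  apply: chain_defect_rows => [|i]; apply/rowP=> j; rewrite -coefsum vB coefXM /=.
    by rewrite mxE.
  by rewrite coefsum.
apply: contraNneq v_neq0 => X0; apply/eqP/rowP=> j; apply/polyP=> i.
by rewrite -Xi X0 rowz0 !mxE coef0.
Qed.

(** * The decomposition *)

Lemma skew_pair_splits (K : closedFieldType) N (A B : 'M[K]_N) :
  2%N \notin [pchar K] -> (0 < N)%N -> A^T = - A -> B^T = - B -> splits A B.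
Proof.
move=> char2; elim/ltn_ind: N => N IHN in A B *; move=> N_gt0 skA skB.
have IH : splits_below K N.
  by move=> M A' B' /andP[M_gt0 lt_MN]; apply: IHN.
have [det0|det_neq0] := eqVneq (\det (map_mx polyC B - 'X *: map_mx polyC A)) 0.
  have [n [X [XAB X_neq0]]] := singular_chain det0.
  have [m [L [L_chain L_neq0 L_min]]] := minimal_chain XAB X_neq0.
  exact: singular_splits L_chain L_neq0 L_min.
(* The factor ['X] forces x to be nonzero, so mu = 1/x is available and A - mu B is a nonzero
   multiple of B - x A. *)
have /closed_nonrootP[x] : 'X * \det (map_mx polyC B - 'X *: map_mx polyC A) != 0.
  by rewrite mulf_neq0 ?polyX_eq0.
rewrite rootM negb_or rootX => /andP[x_neq0].
rewrite /root -horner_evalE -det_map_mx => det_x.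
have eBA :
    map_mx (horner_eval x) (map_mx polyC B - 'X *: map_mx polyC A) = B - x *: A.
  by apply/matrixP=> i j; rewrite !mxE /horner_eval !hornerE.
apply: (@regular_splits _ _ _ _ x^-1) => //.
have -> : A - x^-1 *: B = - x^-1 *: (B - x *: A).
  by rewrite scalerBr scaleNr scalerA mulNr mulVf // scaleN1r opprK addrC.
by rewrite unitmxZ ?unitrN ?unitrV ?unitfE // unitmxE unitfE -eBA.
Qed.

Lemma canonical_pair_gt0 (K : fieldType) m (A B : 'M[K]_m) :
  canonical_pair A B -> (0 < m)%N.
Proof. by case=> n *; rewrite addn_gt0 ?orbT //; apply/orP; left. Qed.

Lemma gram_castmx (K : fieldType) m m' N (e : m = m') (P : 'M[K]_(m, N))
    (A : 'M[K]_N) :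
  castmx (e, erefl N) P *m A *m (castmx (e, erefl N) P)^T
  = castmx (e, e) (P *m A *m P^T).
Proof. by case: _ / e; rewrite !castmx_id. Qed.

(** Bundling the size with the two matrices lets blocks of different sizes share one sequence. *)
Definition block_pair (K : fieldType) := {m : nat & ('M[K]_m * 'M[K]_m)%type}.

Lemma skew_pair_canonical (K : closedFieldType) N (A B : 'M[K]_N) :
  2%N \notin [pchar K] -> A^T = - A -> B^T = - B ->
  let x0 : block_pair K := existT _ 0%N (0, 0) in
  exists (s : seq (block_pair K))
    (P : 'M_(\sum_(i < size s) tag (nth x0 s i), N)),
  [/\ (\sum_(i < size s) tag (nth x0 s i) = N)%N, (1%:M <= P)%MS,
      P *m A *m P^T = \mxdiag_(i < size s) (tagged (nth x0 s i)).1,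
      P *m B *m P^T = \mxdiag_(i < size s) (tagged (nth x0 s i)).2
    & forall i, (i < size s)%N ->
        canonical_pair (tagged (nth x0 s i)).1 (tagged (nth x0 s i)).2].
Proof.
move=> char2; elim/ltn_ind: N => N IHN in A B *; move=> skA skB x0.
have [N0|N_gt0] := posnP N.
  have no_ord i : (i < \sum_(j < size [::]) tag (nth x0 [::] j))%N -> False.
    by rewrite big_ord0.
  exists [::], 0; split=> //.
  - by rewrite big_ord0 N0.
  - by apply/row_subP=> -[i lt_i]; exfalso; move: lt_i; rewrite N0.
  - by apply/matrixP=> -[i /[dup] /no_ord].
  - by apply/matrixP=> -[i /[dup] /no_ord].
have [m [A1 [B1 [P1 [r [P2 [can1 mr full [eA1 eB1] [oA oB]]]]]]]] :=
  skew_pair_splits char2 N_gt0 skA skB.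
have lt_rN : (r < N)%N.
  by rewrite -mr -[X in (X < _)%N]add0n ltn_add2r (canonical_pair_gt0 can1).
have [s [P [dimP fullP eA eB can_s]]] :=
  IHN r lt_rN _ _ (skew_gram P2 skA) (skew_gram P2 skB).
pose x : block_pair K := existT _ m (A1, B1).
pose d (i : 'I_(size s).+1) := tag (nth x0 (x :: s) i).
pose Q := col_mx P1 (P *m P2).
have offdiag M : M^T = - M -> P1 *m M *m P2^T = 0 ->
    Q *m M *m Q^T =
    block_mx (P1 *m M *m P1^T) 0 0 (P *m (P2 *m M *m P2^T) *m P^T).
  move=> skM oM; rewrite /Q tr_col_mx mul_col_mx mul_col_row trmx_mul.
  rewrite !mulmxA oM mul0mx; congr block_mx.
  apply: trmx_inj; rewrite !trmx_mul !trmxK skM trmx0 mulNmx mulmxN.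
  by rewrite !mulmxA oM mul0mx oppr0.
exists (x :: s), (castmx (mxsize_recl (p_ := d), erefl N) Q).
split.
- by rewrite /= big_ord_recl /= dimP.
- case: _ / mxsize_recl => /=; rewrite castmx_id.
  apply: (submx_trans full); rewrite -addsmxE addsmxS //.
  by rewrite -{1}[P2]mul1mx submxMr.
- rewrite gram_castmx offdiag // eA1 eA [RHS]mxdiag_recl //.
- rewrite gram_castmx offdiag // eB1 eB [RHS]mxdiag_recl //.
- by case=> [|i] //=; rewrite ltnS => /can_s.
Qed.

Lemma gram_mx_lincomb (K : fieldType) (V : vectType K) (F : {skew_symmetric V})
    N (e : N.-tuple V) m (P : 'M[K]_(m, N)) :
  gram_mx F [tuple \sum_j P i j *: tnth e j | i < m]
  = P *m gram_mx F e *m P^T.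
Proof.
apply/matrixP=> p q; rewrite mxE !tnth_mktuple -mulmxA mxE linear_sumlz.
apply: eq_bigr => i _; rewrite mxE linearZl_LR linear_sumr; congr (_ * _).
apply: eq_bigr => j _; rewrite linearZr_LR !mxE; exact: mulrC.
Qed.

Theorem theorem1 (K : closedFieldType) (charK : 2%N \notin [pchar K])
    (V : vectType K) (A B : {skew_symmetric V}) :
  exists (k : nat) (d : 'I_k -> nat) (As Bs : forall i : 'I_k, 'M[K]_(d i))
         (b : (\sum_(i < k) d i)%N.-tuple V),
    [/\ basis_of fullv b,
        gram_mx A b = \mxdiag_(i < k) As i,
        gram_mx B b = \mxdiag_(i < k) Bs i
      & forall i : 'I_k, canonical_pair (As i) (Bs i)].
Proof.
have skew (F : {skew_symmetric V}) :
    (gram_mx F (vbasis {:V}))^T = - gram_mx F (vbasis {:V}).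
  by apply/matrixP=> i j; rewrite !mxE hermC expr1 mulN1r.
have [s [P [dimP fullP eA eB can_s]]] :=
  skew_pair_canonical charK (skew A) (skew B).
pose b := [tuple \sum_j P i j *: tnth (vbasis {:V}) j | i < _].
pose x0 : block_pair K := existT _ 0%N (0, 0).
exists (size s), _, (fun i => (tagged (nth x0 s i)).1),
  (fun i => (tagged (nth x0 s i)).2), b.
split; last by move=> i; apply: can_s.
(* The number of vectors equals dim V, so spanning suffices; it holds because the coordinate row of
   any v is a combination of the rows of [P]. *)
- rewrite basisEdim size_tuple [X in _ && (X <= _)%N]dimP leqnn andbT.
  apply/subvP=> v _; rewrite (coord_vbasis (memvf v)).
  pose c := \row_i coord (vbasis {:V}) i v.
  have /submxP[u uP] : (c <= P)%MS := submx_trans (submx1 _) fullP.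
  have -> : \sum_i coord (vbasis {:V}) i v *: (vbasis {:V})`_i
      = \sum_i u 0 i *: tnth b i.
    under [RHS]eq_bigr => i _ do rewrite tnth_mktuple scaler_sumr.
    rewrite exchange_big; apply: eq_bigr => j _ /=.
    have /rowP/(_ j) := uP; rewrite !mxE => ->; rewrite scaler_suml.
    by apply: eq_bigr => i _; rewrite scalerA -tnth_nth.
  by apply: rpred_sum => i _; rewrite rpredZ // memv_span // mem_tnth.
- by rewrite gram_mx_lincomb.
- by rewrite gram_mx_lincomb.
Qed.
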